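(* Let $A=T(V)/(R)=\Bbbk\langle x_1,\dots,x_n\rangle/(f_1,\dots,f_r)$ be a Koszul algebra. The following are equivalent: (1) $A$ satisfies the (G1) condition; (2) $A$ is semi-standard (i.e. $X_A={}_AX$) and point-exact at degree $1$. Moreover, if $A$ satisfies these equivalent conditions, then $r+1\ge n$, and the geometric pair $(E,\sigma)$ of $A$ is given by $E=X_A={}_AX$ and $\sigma:E\to E$, $p\mapsto q$, where $q$ is such that $(d_1)_p(d_2)_q=0$ (or equivalently $(h_2)_p(h_1)_q=0$).
   Context: $\Bbbk$ is an algebraically closed field of characteristic $0$. A connected graded algebra $A$ ($A_0=\Bbbk$, $A_i=0$ for $i<0$) is Koszul if the right module $\Bbbk_A=A/A_{\ge1}$ has a linear resolution, i.e. a graded projective resolution whose $i$-th term is generated in degree $i$. A Koszul algebra is quadratic: $A=T(V)/(R)$, where $V=A_1$ is finite-dimensional with basis $x_1,\dots,x_n$ and $R\subset V^{\otimes2}$ has basis $f_1,\dots,f_r$. Write $f_i=\sum_j x_jf_{ji}=\sum_j g_{ij}x_j$ with $f_{ji},g_{ij}\in V$. The linear resolution of $\Bbbk_A$ begins $A(-2)^{\oplus r}\xrightarrow{d_2}A(-1)^{\oplus n}\xrightarrow{d_1}A$ with $d_1=(x_1,\dots,x_n)$ and $d_2=(f_{ji})_{j,i}\in\mathbb M_{n\times r}(V)$, and that of the left module ${}_A\Bbbk$ begins $A(-2)^{\oplus r}\xrightarrow{h_2}A(-1)^{\oplus n}\xrightarrow{h_1}A$ with $h_1=(x_1,\dots,x_n)^t$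 and $h_2=(g_{ij})\in\mathbb M_{r\times n}(V)$. For a matrix $M$ over $V$ and $p=(p_1:\cdots:p_n)\in\mathbb P(V^* )=\mathbb P^{n-1}$, $M_p$ is the matrix over $\Bbbk$ (up to scalar) obtained by substituting $x_i\mapsto p_i$. Define $$X_A=\{p:\operatorname{rank}_\Bbbk(d_2)_p<n\},\qquad {}_AX=\{p:\operatorname{rank}_\Bbbk(h_2)_p<n\}.$$ These are assumed to be nonempty (standing assumption). $A$ is point-exact at degree $1$ if $\operatorname{rank}_\Bbbk(d_1)_p+\operatorname{rank}_\Bbbk(d_2)_p=n$ for all $p\in X_A$ and $\operatorname{rank}_\Bbbk(h_1)_p+\operatorname{rank}_\Bbbk(h_2)_p=n$ for all $p\in{}_AX$. (G1) condition: with $\mathcal V(R)=\{(p,q)\in\mathbb P(V^* )\times\mathbb P(V^* ): g(p,q)=0\ \forall g\in R\}$ (where $g=\sum a_{ij}x_i\otimes x_j$ is evaluated as $\sum a_{ij}p_iq_j$), there are a projective variety $E\subset\mathbb P(V^* )$ (a closed subset with reduced structure, possibly reducible) and $\sigma\in\operatorname{Aut}_\Bbbk E$ with $\mathcal V(R)=\{(p,\sigma(p)):p\in E\}$. Then $(E,\sigma)$ is called the geometric pair of $A$. *)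

(* Defs.v *)
From HB Require Import structures.
From mathcomp Require Import all_boot all_algebra.
From mathcomp.multinomials Require Import -(notations) monalg.
From mathcomp.multinomials Require Import mpoly.

Set Implicit Arguments.
Unset Strict Implicit.
Unset Printing Implicit Defensive.

Import GRing.Theory.
Local Open Scope ring_scope.

(* Right A-modules are represented as left modules over the converse ring A^c,
   so that (a : A^c) *: m stands for m * a; A^c^o is A as a right module over
   itself. *)
Section GradedModules.

Definition is_grading (I : choiceType) (M : zmodType) (G : I -> M -> Prop) :=
  [/\ forall i, G i 0 /\ (forall x y, G i x -> G i y -> G i (x - y)),
      forall m, exists (s : seq I) (c : I -> M),
        (forall i, G i (c i)) /\ m = \sum_(i <- s) c i
    & forall (s : seq I) (c : I -> M), uniq s -> (forall i, G i (c i)) ->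
        \sum_(i <- s) c i = 0 -> forall i, i \in s -> c i = 0].

Variables (k : fieldType) (A : algType k) (gr : nat -> A -> Prop).

Definition connected_graded :=
  [/\ is_grading gr,
      forall i j a b, gr i a -> gr j b -> gr (i + j)%N (a * b)
    & forall a, gr 0%N a <-> exists c : k, a = c%:A].

Definition augmentation_ideal (a : A) :=
  exists (N : nat) (c : 'I_N -> A),
    (forall i : 'I_N, gr i.+1 (c i)) /\ a = \sum_(i < N) c i.

Definition is_graded_right_module (M : lmodType A^c) (G : int -> M -> Prop) :=
  is_grading G /\
  forall (i : int) (j : nat) m a,
    G i m -> gr j a -> G (i + j%:Z) ((a : A^c) *: m).

Definition generated_in_degree (M : lmodType A^c) (G : int -> M -> Prop)
    (i : int) :=
  forall m : M, exists (N : nat) (a : 'I_N -> A^c) (g : 'I_N -> M),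
    (forall l, G i (g l)) /\ m = \sum_(l < N) a l *: g l.

Definition is_projective (B : nzRingType) (P : lmodType B) :=
  forall (M N : lmodType B) (g : {linear M -> N}) (f : {linear P -> N}),
    (forall y, exists x, g x = y) ->
    exists h : {linear P -> M}, forall x, g (h x) = f x.

(* K, with the surjection pi : A -> K of kernel A_{>=1}, is the right module
   k_A = A / A_{>=1}, concentrated in degree 0. *)
Definition is_residue_module (K : lmodType A^c) (pi : {linear A^c^o -> K}) :=
  (forall y, exists a, pi a = y) /\
  (forall a, pi a = 0 <-> augmentation_ideal a).

Definition is_linear_resolution (K : lmodType A^c)
    (P : nat -> lmodType A^c) (G : forall i, int -> P i -> Prop)
    (d : forall i, {linear P i.+1 -> P i}) (eps : {linear P 0%N -> K}) :=
  [/\ forall i, [/\ is_graded_right_module (@G i), is_projective (P i)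
                  & generated_in_degree (@G i) i%:Z],
      forall i j m, G i.+1 j m -> G i j (d i m),
      forall j m, G 0%N j m -> j != 0 -> eps m = 0,
      forall y, exists m, eps m = y
    & (forall m, eps m = 0 <-> exists m', d 0%N m' = m) /\
      (forall i m, d i m = 0 <-> exists m', d i.+1 m' = m)].

Definition is_koszul :=
  connected_graded /\
  exists (K : lmodType A^c) (pi : {linear A^c^o -> K}),
    is_residue_module pi /\
    exists P G d eps, @is_linear_resolution K P G d eps.

End GradedModules.

(* V is identified with 'rV[k]_n through the basis x_1, ..., x_n, and V (x) V
   with 'M[k]_n: g stands for \sum_(i, j) g i j x_i (x) x_j. *)
Section TensorAlgebra.
Variables (k : fieldType) (n : nat).

Definition tensor_algebra : lalgType k :=
  monalg.malg (monalg.fmonom 'I_n) k.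

Definition tgen (i : 'I_n) : tensor_algebra := monalg.mkmalgU (monalg.fmu i) 1.

Definition tensor2 (g : 'M[k]_n) : tensor_algebra :=
  \sum_(i < n) \sum_(j < n) g i j *: (tgen i * tgen j).

Definition tensor_degree (d : nat) (t : tensor_algebra) :=
  forall m : monalg.fmonom 'I_n,
    monalg.mcoeff m t != 0 -> monalg.fdeg m = d.

Definition relation_ideal (R : {vspace 'M[k]_n}) (t : tensor_algebra) :=
  exists (N : nat) (a b : 'I_N -> tensor_algebra) (g : 'I_N -> 'M[k]_n),
    (forall l, g l \in R) /\ t = \sum_(l < N) a l * tensor2 (g l) * b l.

(* phi induces an isomorphism T(V)/(R) -> A *)
Definition is_presentation (R : {vspace 'M[k]_n}) (A : algType k)
    (phi : {lrmorphism tensor_algebra -> A}) :=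
  (forall a, exists t, phi t = a) /\
  (forall t, phi t = 0 <-> relation_ideal R t).

Definition presented_degree (A : algType k)
    (phi : {lrmorphism tensor_algebra -> A}) (d : nat) (a : A) :=
  exists2 t, tensor_degree d t & phi t = a.

End TensorAlgebra.

Section ProjectiveSpace.
Variables (k : fieldType) (n : nat).

Definition nzvec := {v : 'rV[k]_n | v != 0}.

(* two nonzero vectors are equivalent if they span the same line *)
Definition same_line (v w : nzvec) := (val v == val w)%MS.

Lemma same_line_refl : reflexive same_line.
Proof. by move=> v; rewrite /same_line submx_refl. Qed.

Lemma same_line_sym : ssrbool.symmetric same_line.
Proof. by move=> v w; rewrite /same_line andbC. Qed.

Lemma same_line_trans : transitive same_line.
Proof.
move=> v u w /andP[uv vu] /andP[vw wv].
by apply/andP; split; [apply: submx_trans uv vw | apply: submx_trans wv vu].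
Qed.

Canonical same_line_equiv :=
  EquivRel same_line same_line_refl same_line_sym same_line_trans.

(* the lines of the dual of V, which is identified with 'rV[k]_n by evaluation
   at x_1, ..., x_n *)
Definition proj := {eq_quot same_line}%qT.

Definition coords (p : proj) : 'rV[k]_n := val (repr p : nzvec).

Definition polyval (g : {mpoly k[n]}) (p : proj) : k :=
  g.@[fun i => coords p 0 i].

Definition zariski_closed (E : proj -> Prop) :=
  exists S : {mpoly k[n]} -> Prop,
    (forall g, S g -> exists d, g \is d.-homog) /\
    (forall p, E p <-> forall g, S g -> polyval g p = 0).

Definition zariski_open (U : proj -> Prop) := zariski_closed (fun p => ~ U p).

(* The restriction of s to E is locally given by n homogeneous polynomials of
   the same degree without common zero. *)
Definition regular_on (E : proj -> Prop) (s : proj -> proj) :=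
  forall p, E p -> exists U : proj -> Prop, [/\ zariski_open U, U p &
    exists (d : nat) (F : 'I_n -> {mpoly k[n]}),
      (forall i, F i \is d.-homog) /\
      forall q, E q -> U q ->
        exists2 c : k, c != 0
          & \row_(i < n) polyval (F i) q = c *: coords (s q)].

(* Maps E -> E are represented by total maps, irrelevant outside of E. *)
Definition is_automorphism (E : proj -> Prop) (s : proj -> proj) :=
  exists t : proj -> proj,
    [/\ forall p, E p -> E (s p) /\ E (t p),
        forall p, E p -> t (s p) = p /\ s (t p) = p,
        regular_on E s
      & regular_on E t].

End ProjectiveSpace.

Section PointSchemes.
Variables (k : fieldType) (n : nat).
Implicit Types (R : {vspace 'M[k]_n}) (p q : proj k n).

Definition tensor_eval (g : 'M[k]_n) p q : k :=
  \sum_(i < n) \sum_(j < n) g i j * coords p 0 i * coords q 0 j.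

Definition zero_locus R p q := forall g, g \in R -> tensor_eval g p q = 0.

Definition geometric_pair R (E : proj k n -> Prop) (s : proj k n -> proj k n) :=
  [/\ zariski_closed E, is_automorphism E s
    & forall p q, zero_locus R p q <-> E p /\ q = s p].

Definition G1 R := exists E s, geometric_pair R E s.

Definition subst_mx (a b : nat) (M : 'M['rV[k]_n]_(a, b)) p : 'M[k]_(a, b) :=
  \matrix_(i, j) \sum_(l < n) M i j 0 l * coords p 0 l.

Definition d1 : 'M['rV[k]_n]_(1, n) := \matrix_(i, j) delta_mx 0 j.
Definition h1 : 'M['rV[k]_n]_(n, 1) := \matrix_(i, j) delta_mx 0 i.

Variables (r : nat) (f : r.-tuple 'M[k]_n).

(* f_i = \sum_j x_j (x) f_ji, so f_ji is the j-th row of f_i; dually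
   f_i = \sum_j g_ij (x) x_j, so g_ij is the j-th column of f_i. *)
Definition d2 : 'M['rV[k]_n]_(n, r) := \matrix_(j, i) row j (tnth f i).
Definition h2 : 'M['rV[k]_n]_(r, n) := \matrix_(i, j) (col j (tnth f i))^T.

Definition right_points p : Prop := (\rank (subst_mx d2 p) < n)%N.
Definition left_points p : Prop := (\rank (subst_mx h2 p) < n)%N.

Definition semi_standard := forall p, right_points p <-> left_points p.

Definition point_exact1 :=
  (forall p, right_points p ->
     (\rank (subst_mx d1 p) + \rank (subst_mx d2 p))%N = n) /\
  (forall p, left_points p ->
     (\rank (subst_mx h1 p) + \rank (subst_mx h2 p))%N = n).

End PointSchemes.

Arguments d1 {k n}.
Arguments h1 {k n}.

(* Main.v *)
(* Both [(d_1)_p (d_2)_q] and [(h_2)_p (h_1)_q] have the entries [f_i(p, q)], so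
   the two projections of [V(R)] are [_AX] and [X_A], and the fibre over a point
   is the projectivised kernel of [(h_2)_p], resp. of the transpose of
   [(d_2)_q]. Point-exactness says that these kernels are lines, i.e. that both
   projections are injective, so with [X_A = _AX] the locus is the graph of a
   bijection. It is an isomorphism since a line that is the kernel of a matrix
   of linear forms is locally given by maximal minors. *)

Require Import Defs.
From HB Require Import structures.
From mathcomp Require Import all_boot all_algebra.
From mathcomp.multinomials Require Import mpoly.

Set Implicit Arguments.
Unset Strict Implicit.
Unset Printing Implicit Defensive.

Import GRing.Theory.
Local Open Scope ring_scope.

(** * Points of projective space and kernels of corank one *)

Section ProjectivePoints.
Variables (k : fieldType) (n : nat).
Implicit Types (p q : proj k n).

Lemma coords_neq0 p : coords p != 0.
Proof. exact: valP (repr p). Qed.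

Lemma proj_eq p q : (coords p <= coords q)%MS -> p = q.
Proof.
move=> le_pq; rewrite -[p]reprK -[q]reprK; apply/eqmodP.
apply/andP; split=> //.
by rewrite -(geq_leqif (mxrank_leqif_sup le_pq)) !rank_rV !coords_neq0.
Qed.

Lemma exists_proj (v : 'rV[k]_n) : v != 0 -> exists p, (coords p == v)%MS.
Proof.
move=> v0; exists (\pi_(proj k n)%qT (exist _ v v0)).
set p := \pi_(proj k n)%qT _.
have /eqmodP // : (repr p = exist _ v v0 %[mod proj k n])%qT.
by rewrite reprK.
Qed.

Lemma rank_lt_kernelP m (M : 'M[k]_(n, m)) :
  (\rank M < n)%N <-> exists p, coords p *m M = 0.
Proof.
split=> [ltM | [p pM]].
  have: kermx M != 0 by rewrite -mxrank_eq0 mxrank_ker subn_eq0 -ltnNge.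
  rewrite -nz_row_eq0 => /exists_proj[p /andP[le_p _]]; exists p.
  by apply/sub_kermxP; apply: submx_trans le_p (nz_row_sub _).
rewrite ltnNge -subn_eq0 -mxrank_ker mxrank_eq0.
apply: contra (coords_neq0 p) => /eqP ker0.
by rewrite -submx0 -ker0; apply/sub_kermxP.
Qed.

(** Every nonzero row of [kermx M] spans a point of the kernel, which can only be [p0]. The kernel
    thus lies in one line, and it is nonzero because the rank is below [n]. *)
Lemma unique_kernel_rank m (M : 'M[k]_(n, m)) :
  (\rank M < n)%N ->
  (forall p q, coords p *m M = 0 -> coords q *m M = 0 -> p = q) ->
  (\rank M).+1 = n.
Proof.
move=> ltM uniqM; have /rank_lt_kernelP[p0 p0M] := ltM.
suff le1: (kermx M <= coords p0)%MS.
  have := mxrankS le1; rewrite mxrank_ker rank_rV coords_neq0 leq_subLR addn1.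
  by move=> leM; apply/eqP; rewrite eqn_leq ltM.
apply/row_subP=> i.
have [->|/exists_proj[p /andP[le_p ge_p]]] := eqVneq (row i (kermx M)) 0.
  exact: sub0mx.
rewrite (uniqM p0 p) //; apply/sub_kermxP.
exact: submx_trans le_p (row_sub _ _).
Qed.

Lemma rank_unique_kernel m (M : 'M[k]_(n, m)) (v : 'rV_n) p :
  (\rank M).+1 = n -> coords p *m M = 0 -> v *m M = 0 -> (v <= coords p)%MS.
Proof.
move=> rkM /sub_kermxP pM /sub_kermxP vM.
have rkK : \rank (kermx M) = 1%N by rewrite mxrank_ker -[X in (X - _)%N]rkM subSnn.
apply: submx_trans vM _.
by rewrite -(geq_leqif (mxrank_leqif_sup pM)) rkK rank_rV coords_neq0.
Qed.

End ProjectivePoints.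

(** * Maximal minors of a matrix with one more column than rows *)

Section SignedMinors.

(* The generalised cross product of the rows of [B]. *)
Definition signed_minors (S : comNzRingType) m (B : 'M[S]_(m, m.+1)) :
  'rV[S]_m.+1 := \row_j ((-1) ^+ j * \det (col' j B)).

Lemma det_col_mx_signed_minors (S : comNzRingType) m (B : 'M[S]_(m, m.+1))
    (v : 'rV[S]_m.+1) :
  \det (col_mx v B : 'M_(1 + m)) = \sum_j v 0 j * signed_minors B 0 j.
Proof.
rewrite (expand_det_row _ (lshift m ord0)); apply: eq_bigr => j _.
rewrite col_mxEu mxE /cofactor add0n; congr (_ * (_ * \det _)).
apply/matrixP=> i l; rewrite [RHS]mxE 2![in LHS]mxE.
have ->: lift (lshift m ord0) i = rshift 1 i by apply: val_inj.
by rewrite col_mxEd.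
Qed.

(** Used to pass from minors of matrices of linear forms, which are polynomials, to their values at
    a point. *)
Lemma map_signed_minors (S T : comNzRingType) (g : {rmorphism S -> T}) m
    (B : 'M[S]_(m, m.+1)) :
  map_mx g (signed_minors B) = signed_minors (map_mx g B).
Proof.
apply/rowP=> j; rewrite !mxE rmorphM rmorph_sign -det_map_mx.
by congr (_ * \det _); apply/matrixP=> i l; rewrite !mxE.
Qed.

Variable k : fieldType.

Lemma mul_signed_minors m (B : 'M[k]_(m, m.+1)) :
  signed_minors B *m B^T = 0.
Proof.
apply/rowP=> i; rewrite !mxE.
(* Each entry is the determinant of [B] with its row [i] repeated on top. *)
transitivity (\det (col_mx (row i B) B : 'M_(1 + m))).
  rewrite det_col_mx_signed_minors; apply: eq_bigr => j _.
  by rewrite mulrC [B^T j i]mxE [row i B 0 j]mxE.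
apply: (determinant_alternate (i1 := lshift m 0) (i2 := rshift 1 i)) => [|j].
  by rewrite eq_lrshift.
by rewrite col_mxEu col_mxEd mxE.
Qed.

(** By Laplace expansion, the determinant of a row [v] on top of [B] pairs [v] with the signed
    minors. So they all vanish exactly when no [v] completes [B] to an invertible matrix, that is,
    when the rows of [B] are dependent. *)
Lemma signed_minors_eq0 m (B : 'M[k]_(m, m.+1)) :
  (signed_minors B == 0) = (\rank B < m)%N.
Proof.
apply/eqP/idP=> [sm0 | ltB].
  rewrite ltnNge; apply/negP=> geB.
  (* Having only [m] rows, [B] misses some coordinate vector; adding it raises the rank to
     [m.+1]. *)
  have: ~~ (1%:M <= B)%MS by rewrite sub1mx -col_leq_rank -ltnNge ltnS rank_leq_row.
  case/row_subPn=> i; set v := row i _ => vB.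
  suff: (col_mx v B : 'M_(1 + m)) \in unitmx.
    rewrite unitmxE det_col_mx_signed_minors sm0 big1 ?unitr0 // => j _.
    by rewrite [X in _ * X]mxE mulr0.
  rewrite -row_full_unit -col_leq_rank /= -addsmxE.
  apply: leq_ltn_trans geB _; apply: rank_ltmx.
  by rewrite /ltmx addsmxSr addsmx_sub negb_and vB.
apply/rowP=> j; rewrite [RHS]mxE; apply/eqP; apply: contraTT ltB => smj.
rewrite -leqNgt -ltnS.
(* The [j]-th coordinate vector pairs to the [j]-th signed minor, here nonzero. *)
have: (col_mx (delta_mx 0 j) B : 'M_(1 + m)) \in unitmx.
  rewrite unitmxE unitfE det_col_mx_signed_minors (bigD1 j) //= big1 => [|l lj].
    by rewrite mxE !eqxx mul1r addr0.
  by rewrite mxE eqxx (negPf lj) mul0r.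
move/mxrank_unit=> rkC; rewrite -[X in (X <= _)%N]rkC -addsmxE -[X in (_ <= X)%N]add1n.
apply: leq_trans (mxrank_adds_leqif _ _) _.
by rewrite leq_add2r rank_leq_row.
Qed.

End SignedMinors.

(** * Matrices of linear forms and their degeneracy loci *)

Section LinearForms.
Variables (k : fieldType) (n : nat).
Implicit Types (p q : proj k n).

Lemma trmx_subst_mx a b (M : 'M['rV[k]_n]_(a, b)) p :
  (subst_mx M p)^T = subst_mx M^T p.
Proof. by apply/matrixP=> i j; rewrite !mxE. Qed.

(** Viewing the entries as polynomials makes determinants available before a point is
    substituted. *)
Definition linear_forms a b (M : 'M['rV[k]_n]_(a, b)) : 'M[{mpoly k[n]}]_(a, b) :=
  \matrix_(i, j) \sum_(l < n) M i j 0 l *: 'X_l.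

Lemma meval_linear_forms a b (M : 'M['rV[k]_n]_(a, b)) p :
  map_mx (meval (fun i => coords p 0 i)) (linear_forms M) = subst_mx M p.
Proof.
apply/matrixP=> i j; rewrite !mxE raddf_sum; apply: eq_bigr => l _ /=.
by rewrite mevalZ mevalXU.
Qed.

Lemma linear_forms_homog a b (M : 'M['rV[k]_n]_(a, b)) i j :
  linear_forms M i j \is 1.-homog.
Proof.
rewrite mxE; apply: rpred_sum => l _.
by rewrite rpredZ // dhomogX /= mdeg1.
Qed.

Lemma det_homog m (B : 'M[{mpoly k[n]}]_m) :
  (forall i j, B i j \is 1.-homog) -> \det B \is m.-homog.
Proof.
move=> homB; apply: rpred_sum => s _; rewrite rpredMsign.
(* Each Leibniz term is a product of [m] linear forms; the matrix and the permutation are forgotten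
   so that induction on [m] applies. *)
suff: forall F : 'I_m -> {mpoly k[n]}, (forall i, F i \is 1.-homog) ->
  \prod_i F i \is m.-homog by apply.
elim: m {B homB s} => [|m IHm] F homF; first by rewrite big_ord0 dhomog1.
rewrite big_ord_recr /=; have {}IHm := IHm _ (fun i => homF (widen_ord (leqnSn m) i)).
by have := dhomogM IHm (homF ord_max); rewrite addn1.
Qed.

(** The equations are the maximal minors, of degree [n]. The row selection [h] is arbitrary:
    repeated rows only contribute zero minors. *)
Lemma degeneracy_locus_closed m (M : 'M['rV[k]_n]_(m, n)) :
  zariski_closed (fun p => (\rank (subst_mx M p) < n)%N).
Proof.
exists (fun g => exists h : 'I_n -> 'I_m, g = \det (rowsub h (linear_forms M))).
split=> [g [h ->] | p].
  exists n; apply: det_homog => i j; rewrite mxE; exact: linear_forms_homog.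
have evalE (h : 'I_n -> 'I_m) :
    polyval (\det (rowsub h (linear_forms M))) p
    = \det (rowsub h (subst_mx M p)).
  by rewrite /polyval -det_map_mx map_mxsub meval_linear_forms.
split=> [ltM g [h ->] | minors0].
  rewrite evalE; apply/eqP; apply: contraTT ltM => det0.
  rewrite -leqNgt -[X in (X <= _)%N](mxrank_unit (A := rowsub h (subst_mx M p))).
    exact: mxrankS (rowsub_sub _ _).
  by rewrite unitmxE unitfE.
rewrite ltnNge col_leq_rank; apply/negP=> fullM.
have := fullrowsub_unit fullM.
by rewrite unitmxE -evalE minors0 ?unitr0 //; exists (fullrankfun fullM).
Qed.

End LinearForms.

(* Near a point where the kernel is a line, it is spanned by the signed maximal
   minors of a suitable choice of rows. *)
Lemma kernel_map_regular (k : fieldType) n m (M : 'M['rV[k]_n]_(m, n))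
    (E : proj k n -> Prop) (s : proj k n -> proj k n) :
  (forall p, E p -> (\rank (subst_mx M p)).+1 = n) ->
  (forall p, E p -> coords (s p) *m (subst_mx M p)^T = 0) ->
  regular_on E s.
Proof.
(* For [n = 0] the rank hypothesis at [p] is absurd. From here on there are [n.+1] coordinates. *)
case: n M E s => [|n] M E s rkM ker_s p Ep; first by have := rkM p Ep.
have rkp : \rank (subst_mx M p) = n by apply: succn_inj; apply: rkM.
(* Select [n] rows independent at [p]; they stay independent on the open set where one of their
   maximal minors is nonzero. *)
have [h rkh] : exists h : 'I_n -> 'I_m, \rank (rowsub h (subst_mx M p)) = n.
  have := maxrowsub_free (subst_mx M p); rewrite /row_free.
  by move: (maxrankfun _); rewrite rkp => h /eqP; exists h.
pose F i := signed_minors (rowsub h (linear_forms M)) 0 i.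
have evalF q : \row_i polyval (F i) q = signed_minors (rowsub h (subst_mx M q)).
  rewrite -(meval_linear_forms M) -map_mxsub -map_signed_minors.
  by apply/rowP=> i; rewrite mxE [RHS]mxE.
have homF i : F i \is n.-homog.
  rewrite /F mxE rpredMsign; apply: det_homog => a b.
  by have := linear_forms_homog M (h a) (lift i b); rewrite !mxE.
exists (fun q => exists i, polyval (F i) q != 0); split.
- exists (fun g => exists i, g = F i); split=> [g [i ->] | q].
    by exists n.
  split=> [nU g [i ->] | F0 [i /eqP]]; last by apply; apply: F0; exists i.
  by apply/eqP; apply: contra_notT nU; exists i.
- have: signed_minors (rowsub h (subst_mx M p)) != 0.
    by rewrite signed_minors_eq0 rkh ltnn.
  by rewrite -evalF => /rV0Pn[i]; rewrite mxE; exists i.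
exists n, F; split=> // q Eq [i Fi].
have sm0 : signed_minors (rowsub h (subst_mx M q)) != 0.
  by rewrite -evalF; apply/rV0Pn; exists i; rewrite mxE.
have rkq : (\rank (rowsub h (subst_mx M q))^T).+1 = n.+1.
  rewrite mxrank_tr; congr _.+1; apply/eqP.
  by rewrite eqn_leq rank_leq_row leqNgt -signed_minors_eq0.
have ker_sq : coords (s q) *m (rowsub h (subst_mx M q))^T = 0.
  apply/rowP=> a; have /rowP/(_ (h a)) := ker_s q Eq.
  by rewrite !mxE; apply: etrans; apply: eq_bigr => b _; rewrite !mxE.
(* Both the minors and [s q] lie in the kernel of the selected rows, which is a line at [q]. *)
have /sub_rVP[c smE] := rank_unique_kernel rkq ker_sq (mul_signed_minors _).
exists c; last by rewrite evalF.
by apply: contraNneq sm0 => c0; rewrite smE c0 scale0r.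
Qed.

(** * The locus of the relations, its projections and the geometric pair *)

Section PointSchemes.
Variables (k : fieldType) (n r : nat) (R : {vspace 'M[k]_n}).
Variable f : r.-tuple 'M[k]_n.
Hypothesis basis_f : basis_of R f.
Implicit Types p q : proj k n.

Lemma tensor_eval_d2 p q i :
  tensor_eval (tnth f i) p q = (coords p *m subst_mx (d2 f) q) 0 i.
Proof.
rewrite mxE; apply: eq_bigr => j _; rewrite !mxE mulr_sumr.
by apply: eq_bigr => l _; rewrite !mxE [RHS]mulrCA mulrA.
Qed.

Lemma tensor_eval_h2 p q i :
  tensor_eval (tnth f i) p q = (coords q *m (subst_mx (h2 f) p)^T) 0 i.
Proof.
rewrite mxE /tensor_eval exchange_big; apply: eq_bigr => j _ /=.
rewrite !mxE mulr_sumr.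
by apply: eq_bigr => l _; rewrite !mxE mulrC.
Qed.

Lemma zero_locus_basis p q :
  zero_locus R p q <-> forall i, tensor_eval (tnth f i) p q = 0.
Proof.
split=> [R0 i | f0 g].
  by apply: R0; rewrite -(span_basis basis_f) memv_span ?mem_tnth.
rewrite -(span_basis basis_f) => /coord_span->.
have lin : linear_for *%R (fun g0 => tensor_eval g0 p q).
  move=> c u v; rewrite /tensor_eval mulr_sumr -big_split; apply: eq_bigr => i _.
  rewrite mulr_sumr -big_split; apply: eq_bigr => j _ /=.
  by rewrite !mxE !mulrDl !mulrA.
elim/big_rec: _ => [|i u _ u0].
  by rewrite /tensor_eval big1 // => i _; rewrite big1 // => j _; rewrite mxE !mul0r.
by rewrite lin u0 -tnth_nth f0 mulr0 addr0.
Qed.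

Lemma zero_locus_d2 p q : zero_locus R p q <-> coords p *m subst_mx (d2 f) q = 0.
Proof.
rewrite zero_locus_basis; split=> [f0 | /rowP pq0 i].
  by apply/rowP=> i; rewrite -tensor_eval_d2 f0 mxE.
by rewrite tensor_eval_d2 pq0 mxE.
Qed.

Lemma zero_locus_h2 p q :
  zero_locus R p q <-> coords q *m (subst_mx (h2 f) p)^T = 0.
Proof.
rewrite zero_locus_basis; split=> [f0 | /rowP pq0 i].
  by apply/rowP=> i; rewrite -tensor_eval_h2 f0 mxE.
by rewrite tensor_eval_h2 pq0 mxE.
Qed.

Lemma right_pointsP q : right_points f q <-> exists p, zero_locus R p q.
Proof.
rewrite /right_points rank_lt_kernelP.
by split=> -[p /zero_locus_d2]; exists p.
Qed.

Lemma left_pointsP p : left_points f p <-> exists q, zero_locus R p q.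
Proof.
rewrite /left_points -mxrank_tr rank_lt_kernelP.
by split=> -[q /zero_locus_h2]; exists q.
Qed.

Lemma subst_d1 p : subst_mx d1 p = coords p.
Proof.
apply/rowP=> j; rewrite !mxE (bigD1 j) //= big1 => [|l lj].
  by rewrite !mxE !eqxx mul1r addr0.
by rewrite !mxE eqxx (negPf lj) mul0r.
Qed.

Lemma subst_h1 p : subst_mx h1 p = (coords p)^T.
Proof.
rewrite -subst_d1 trmx_subst_mx; congr subst_mx.
by apply/matrixP=> i j; rewrite !mxE.
Qed.

(** At a point, [d1] and [h1] become the nonzero coordinate vector and its transpose, hence have
    rank one. *)
Lemma point_exact1P : point_exact1 f <->
  (forall p, right_points f p -> (\rank (subst_mx (d2 f) p)).+1 = n) /\
  (forall p, left_points f p -> (\rank (subst_mx (h2 f) p)).+1 = n).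
Proof.
rewrite /point_exact1.
have rk1 p : \rank (subst_mx d1 p) = 1%N by rewrite subst_d1 rank_rV coords_neq0.
have rk1' p : \rank (subst_mx h1 p) = 1%N.
  by rewrite subst_h1 mxrank_tr rank_rV coords_neq0.
by split=> -[ex1 ex2]; split=> p /[dup] Xp; [move/ex1|move/ex2|move/ex1|move/ex2];
  rewrite ?rk1 ?rk1' add1n.
Qed.

(** Both projections of the graph of a bijection of [E] are [E]. The kernel for [h2] at [p] contains
    only the point [s p], and the one for [d2] only its preimage under [s]. *)
Lemma geometric_pair_points E s : geometric_pair R E s ->
  [/\ forall p, E p <-> right_points f p,
      forall p, E p <-> left_points f p & point_exact1 f].
Proof.
move=> [_ [t [Est ts _ _]] zeroE].
have rightE p : E p <-> right_points f p.
  rewrite right_pointsP; split=> [Ep | [q /zeroE[Eq ->]]]; last exact: (Est q Eq).1.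
  by exists (t p); apply/zeroE; have [_ Etp] := Est p Ep; have [_ ->] := ts p Ep.
have leftE p : E p <-> left_points f p.
  rewrite left_pointsP; split=> [Ep | [q /zeroE[]//]].
  by exists (s p); apply/zeroE.
split=> //; apply/point_exact1P; split=> p Xp.
  apply: unique_kernel_rank => // a b.
  move=> /zero_locus_d2/zeroE[Ea pa] /zero_locus_d2/zeroE[Eb pb].
  by rewrite -(ts a Ea).1 -pa pb (ts b Eb).1.
rewrite -mxrank_tr; apply: unique_kernel_rank; first by rewrite mxrank_tr.
by move=> a b /zero_locus_h2/zeroE[_ ->] /zero_locus_h2/zeroE[_ ->].
Qed.

(* The value outside the degeneracy locus is junk. *)
Definition kernel_point m (M : 'M[k]_(n, m)) p : proj k n :=
  if insub (nz_row (kermx M)) is Some v then \pi_(proj k n)%qT v else p.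

Lemma kernel_pointP m (M : 'M[k]_(n, m)) p :
  (\rank M < n)%N -> coords (kernel_point M p) *m M = 0.
Proof.
rewrite /kernel_point; case: insubP => [v _ vE | /negbNE ker0 ltM].
  move=> _; apply/sub_kermxP; apply: submx_trans (nz_row_sub _).
  rewrite -vE; set c := \pi_(proj k n)%qT v.
  by have /eqmodP/andP[] : (repr c = v %[mod proj k n])%qT by rewrite reprK.
by move: ker0; rewrite nz_row_eq0 -mxrank_eq0 mxrank_ker subn_eq0 leqNgt ltM.
Qed.

Lemma point_exact1_geometric_pair : semi_standard f -> point_exact1 f ->
  geometric_pair R (left_points f) (fun p => kernel_point (subst_mx (h2 f) p)^T p).
Proof.
move=> semi /point_exact1P[ex_d ex_h].
set s := fun p => _; pose t p := kernel_point (subst_mx (d2 f) p) p.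
have sP p : left_points f p -> zero_locus R p (s p).
  by move=> Xp; apply/zero_locus_h2/kernel_pointP; rewrite mxrank_tr.
have tP p : left_points f p -> zero_locus R (t p) p.
  by move=> /semi Xp; apply/zero_locus_d2/kernel_pointP.
have uniq_s p q q' : zero_locus R p q -> zero_locus R p q' -> q = q'.
  move=> pq pq'; have Xp : left_points f p by apply/left_pointsP; exists q.
  move/zero_locus_h2: pq => pq; move/zero_locus_h2: pq' => pq'.
  by apply: proj_eq; apply: rank_unique_kernel pq' pq; rewrite mxrank_tr ex_h.
have uniq_t p p' q : zero_locus R p q -> zero_locus R p' q -> p = p'.
  move=> pq pq'; have Xp : right_points f q by apply/right_pointsP; exists p.
  move/zero_locus_d2: pq => pq; move/zero_locus_d2: pq' => pq'.
  by apply: proj_eq; apply: rank_unique_kernel pq' pq; rewrite ex_d.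
(* As a second projection [s p] is a right point; semi-standardness brings it back to the left
   points. *)
have Es p : left_points f p -> left_points f (s p).
  by move=> /sP ps; apply/semi/right_pointsP; exists p.
have Et p : left_points f p -> left_points f (t p).
  by move=> /tP pt; apply/left_pointsP; exists p.
split.
- exact: degeneracy_locus_closed.
- exists t; split=> p Xp.
  + by split; [apply: Es | apply: Et].
  (* The pairs [(t (s p), s p)] and [(p, s p)] both lie in the locus, so their first entries agree;
     dually for [s (t p)]. *)
  + split; first exact: uniq_t (tP _ (Es _ Xp)) (sP _ Xp).
    exact: uniq_s (sP _ (Et _ Xp)) (tP _ Xp).
  + apply: (kernel_map_regular (M := h2 f)) Xp => q Xq; first exact: ex_h.
    exact/zero_locus_h2/sP.
  (* [t] picks a left kernel of [d2], so the regularity criterion is applied to the transpose. *)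
  apply: (kernel_map_regular (M := (d2 f)^T)) Xp => q Xq.
    by rewrite -trmx_subst_mx mxrank_tr; apply/ex_d/semi.
  by rewrite -trmx_subst_mx trmxK; apply/zero_locus_d2/tP.
move=> p q; split=> [pq | [Xp ->]]; last exact: sP.
have Xp : left_points f p by apply/left_pointsP; exists q.
by split=> //; apply: uniq_s pq (sP _ Xp).
Qed.

End PointSchemes.

Theorem lemma3p8 (k : closedFieldType) (hchar : [pchar k] =i pred0)
    (n r : nat) (R : {vspace 'M[k]_n}) (f : r.-tuple 'M[k]_n)
    (hf : basis_of R f)
    (A : algType k) (phi : {lrmorphism tensor_algebra k n -> A})
    (hA : is_presentation R phi)
    (hK : is_koszul (presented_degree phi))
    (hX : exists p, right_points f p) (hX' : exists p, left_points f p) :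
  (G1 R <-> semi_standard f /\ point_exact1 f) /\
  (G1 R ->
     (n <= r + 1)%N /\
     forall (E : proj k n -> Prop) (sigma : proj k n -> proj k n),
       geometric_pair R E sigma ->
       [/\ forall p, E p <-> right_points f p,
           forall p, E p <-> left_points f p
         & forall p, E p -> forall q,
             (sigma p = q <-> subst_mx d1 p *m subst_mx (d2 f) q = 0) /\
             (sigma p = q <-> subst_mx (h2 f) p *m subst_mx h1 q = 0)]).
Proof.
split=> [|[E0 [s0 /(geometric_pair_points hf)[rightE leftE /(point_exact1P f)[ex_d _]]]]].
  split=> [[E [s /(geometric_pair_points hf)[rightE leftE ex]]] | [semi ex]].
    by split=> // p; rewrite -rightE -leftE.
  by exists (left_points f); eexists; exact: point_exact1_geometric_pair.
split=> [|E s gp].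
  (* At a point of the nonempty [X_A], [n] is one more than the rank of [d2], which has [r]
     columns. *)
  have [p /ex_d <-] := hX.
  by rewrite addn1 ltnS rank_leq_col.
have [rightE' leftE' _] := geometric_pair_points hf gp.
split=> // p Ep q.
have sE : s p = q <-> zero_locus R p q.
  have [_ _ ->] := gp; by split=> [<- | [_ ->]].
split; rewrite sE.
  by rewrite subst_d1; exact: zero_locus_d2.
(* The product of [h2] at [p] and [h1] at [q] is the transpose of the row in [zero_locus_h2]. *)
rewrite subst_h1 (zero_locus_h2 hf) -[X in X *m _]trmxK -trmx_mul.
by split=> /(congr1 trmx); rewrite ?trmxK trmx0.
Qed.
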